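(* Let $\varphi(x)\neq-\infty$ be a tropical rational function on $\mathbb{R}$. Then there is an expression $\varphi=f\oslash g$, with $f,g\in\mathbb{T}[x^{\pm1}]$ and $g\neq-\infty$, of minimum volume, i.e. such that $\mathrm{vol}(f,g)\le\mathrm{vol}(f'',g'')$ for all $f'',g''\in\mathbb{T}[x^{\pm1}]$ with $g''\neq-\infty$ and $\varphi=f''\oslash g''$. Moreover, if $f',g'\in\mathbb{T}[x^{\pm1}]$, $g'\neq-\infty$, also satisfy $\varphi=f'\oslash g'$ and $\mathrm{vol}(f',g')=\mathrm{vol}(f,g)$, then the dual subdivision of $f\oplus(y\odot g)$ is a translation of the dual subdivision of $f'\oplus(y\odot g')$. In other words, the dual subdivision of $f\oplus(y\odot g)$ for a minimum volume expression $\varphi=f\oslash g$ is unique up to translation.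
   Context: Tropical algebra: $\mathbb{T}=\mathbb{R}\cup\{-\infty\}$ with $x\oplus y=\max\{x,y\}$, $x\odot y=x+y$, and $x\oslash y=x-y$ for $y\ne-\infty$. A tropical polynomial (always meaning tropical Laurent polynomial) in $n$ variables is a formal expression $f=\bigoplus_{\mathbf{i}\in\mathbb{Z}^n}c_{\mathbf{i}}\mathbf{x}^{\mathbf{i}}$ with $c_{\mathbf{i}}\in\mathbb{T}$, only finitely many $c_{\mathbf{i}}\neq-\infty$; the set of these is $\mathbb{T}[x_1^{\pm1},\dots,x_n^{\pm1}]$, with the natural $\oplus$ and $\odot$. The polynomial all of whose coefficients are $-\infty$ is denoted $-\infty$. A tropical polynomial defines a function $\mathbb{R}^n\to\mathbb{R}\cup\{-\infty\}$ by $f(\mathbf{t})=\max_{\mathbf{i}}(c_{\mathbf{i}}+\mathbf{i}\cdot\mathbf{t})$. For $g\neq-\infty$, $f\oslash g$ is the function $\mathbf{t}\mapsto f(\mathbf{t})-g(\mathbf{t})$. A tropical rational function on $\mathbb{R}^n$ is a function of the form $f\oslash g$ with $f,g$ tropical polynomials, $g\neq-\infty$; equalities $\varphi=f\oslash g$ are equalities of functions. Newton polytope and dual subdivision: $\mathrm{Newt}(f)\subset\mathbb{R}^n$ is the convex hull of $\{\mathbf{i}\in\mathbb{Z}^n\mid c_{\mathbf{i}}\neq-\infty\}$. Let $\Delta_f^{\uparrow}\subset\mathbb{R}^{n+1}$ be the convex hull of $\{(\mathbf{i},\alpha)\in\mathbb{Z}^n\times\mathbb{R}\mid\alpha\le c_{\mathbf{i}}\}$.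 The projections to $\mathbb{R}^n$ of the bounded faces of $\Delta_f^{\uparrow}$ form a lattice subdivision of $\mathrm{Newt}(f)$, called the dual subdivision of $f$ and denoted $\Delta_f$. Volume of a pair: for $f,g\in\mathbb{T}[x_1^{\pm1},\dots,x_n^{\pm1}]$, $\mathrm{vol}(f,g)$ is the $(n+1)$-dimensional volume of $\mathrm{Newt}(f\oplus(x_{n+1}\odot g))\subset\mathbb{R}^{n+1}$ if its affine span has dimension $n+1$, and $\mathrm{vol}(f,g)=0$ otherwise. Here $n=1$ and the additional variable $x_2$ is written $y$. *)

(* Defs.v *)
From HB Require Import structures.
From mathcomp Require Import all_boot all_order all_algebra finmap.
From mathcomp Require Import all_classical all_reals all_analysis.

Set Implicit Arguments.
Unset Strict Implicit.
Unset Printing Implicit Defensive.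

Import Order.TTheory GRing.Theory Num.Theory numFieldNormedType.Exports.

Local Open Scope classical_set_scope.
Local Open Scope ring_scope.

(* A tropical Laurent polynomial is the finite map sending each exponent whose
   coefficient is not -oo to that coefficient; the exponents outside the domain
   are those with coefficient -oo. *)
Definition tpoly (R : realType) (n : nat) : Type := {fmap 'rV[int]_n -> R}.

Section TropicalPolynomials.
Context {R : realType}.
Implicit Types n : nat.

Definition tcoef n (f : tpoly R n) (i : 'rV[int]_n) : \bar R :=
  if f.[? i]%fmap is Some c then c%:E else -oo%E.

(* The intended [c] takes no value +oo and is -oo outside [S]. *)
Definition tpoly_of n (S : {fset 'rV[int]_n}) (c : 'rV[int]_n -> \bar R) :
    tpoly R n :=
  [fmap i : [fset i in S | c i \is a fin_num]%fset => fine (c (val i))]%fmap.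

Definition tzero n : tpoly R n := [fmap]%fmap.

Definition tadd n (f g : tpoly R n) : tpoly R n :=
  tpoly_of (domf f `|` domf g)%fset
    (fun i => Order.max (tcoef f i) (tcoef g i)).

Definition tmul n (f g : tpoly R n) : tpoly R n :=
  tpoly_of [fset (i + j)%R | i in domf f, j in domf g]%fset
    (fun k => \big[Order.max/-oo%E]_(i <- domf f)
                (tcoef f i + tcoef g (k - i)%R)%E).

(* A polynomial in x_1, ..., x_n seen as a polynomial in x_1, ..., x_(n+1). *)
Definition tlift n (f : tpoly R n) : tpoly R (n + 1) :=
  tpoly_of [fset row_mx i (0 : 'rV[int]_1)%R | i in domf f]%fset
    (fun k => if rsubmx k == 0 then tcoef f (lsubmx k) else -oo%E).

(* The monomial x_(n+1), with tropical coefficient 0. *)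
Definition tlastvar n : tpoly R (n + 1) :=
  [fmap].[row_mx 0 (const_mx 1) <- 0]%fmap.

Definition tpencil n (f g : tpoly R n) : tpoly R (n + 1) :=
  tadd (tlift f) (tmul (tlastvar n) (tlift g)).

Definition dotr n (u v : 'rV[R]_n) : R := \sum_(k < n) u 0 k * v 0 k.

Definition zvec n (i : 'rV[int]_n) : 'rV[R]_n := map_mx intr i.

Definition teval n (f : tpoly R n) (t : 'rV[R]_n) : \bar R :=
  \big[Order.max/-oo%E]_(i <- domf f) (tcoef f i + (dotr (zvec i) t)%:E)%E.

Definition tquot n (f g : tpoly R n) (t : 'rV[R]_n) : \bar R :=
  (teval f t - teval g t)%E.

Definition texpresses n (phi : 'rV[R]_n -> \bar R) (f g : tpoly R n) : Prop :=
  g <> tzero n /\ phi = tquot f g.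

Definition trational n (phi : 'rV[R]_n -> \bar R) : Prop :=
  exists f g : tpoly R n, texpresses phi f g.

End TropicalPolynomials.

Section Polyhedra.
Context {R : realType}.
Implicit Types n : nat.

Definition conv_hull n (A : set 'rV[R]_n) : set 'rV[R]_n :=
  smallest (fun C : set 'rV[R]_n => convex_set C) A.

Definition affine_set n (A : set 'rV[R]_n) : Prop :=
  forall (x y : 'rV[R]_n) (t : R), A x -> A y -> A (t *: x + (1 - t) *: y).

Definition affine_span n (A : set 'rV[R]_n) : set 'rV[R]_n :=
  smallest (@affine_set n) A.

(* Nonempty faces; [u = 0] gives the polyhedron [P] itself. *)
Definition face n (P F : set 'rV[R]_n) : Prop :=
  F !=set0 /\
  exists u : 'rV[R]_n,
    F = [set x | P x /\ forall y, P y -> dotr u y <= dotr u x].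

Definition newt n (f : tpoly R n) : set 'rV[R]_n :=
  conv_hull [set zvec i | i in [set i | tcoef f i != -oo%E]].

(* The last coordinate of 'rV_(n + 1) is the height. *)
Definition newt_up n (f : tpoly R n) : set 'rV[R]_(n + 1) :=
  conv_hull [set x | exists (i : 'rV[int]_n) (a : R),
                       (a%:E <= tcoef f i)%E /\ x = row_mx (zvec i) (const_mx a)].

Definition dual_subdivision n (f : tpoly R n) : set (set 'rV[R]_n) :=
  [set lsubmx @` F | F in [set F | face (newt_up f) F /\ bounded_set F]].

Definition translation_of n (S T : set (set 'rV[R]_n)) : Prop :=
  exists v : 'rV[R]_n, S = [set [set x + v | x in C] | C in T].

Definition area (A : set 'rV[R]_(1 + 1)) : \bar R :=
  (lebesgue_measure \x lebesgue_measure)%E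
    [set p : R * R | A (row_mx (const_mx p.1) (const_mx p.2))].

(* An affine subspace of R^2 has dimension 2 iff it is all of R^2. *)
Definition vol (f g : tpoly R 1) : \bar R :=
  if `[< affine_span (newt (tpencil f g)) = setT >]
  then area (newt (tpencil f g)) else 0%E.

Definition min_volume_expression (phi : 'rV[R]_1 -> \bar R) (f g : tpoly R 1) :
    Prop :=
  texpresses phi f g /\
  forall f'' g'' : tpoly R 1, texpresses phi f'' g'' ->
    (vol f g <= vol f'' g'')%E.

End Polyhedra.

(* Main.v *)
Require Import Defs.
From mathcomp Require Import all_boot all_order all_algebra finmap.
From mathcomp Require Import all_classical all_reals all_analysis.
From mathcomp Require Import measurable_realfun.
From mathcomp Require Import ring lra zify.

(** In one variable the function of a nonzero tropical polynomial factors
    uniquely as [c + m x + \sum_(r in s) max(x, r)], with a real [c], an integer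
    [m] and a finite multiset [s] of roots ([tpoly_roots],
    [root_product_roots]); every such function comes from a polynomial
    ([root_product_tpoly]), and the number of roots is the length of the Newton
    interval. The Newton polytope of [f + y g] is the trapezoid whose parallel
    sides are the Newton intervals of [f] and [g], so that [vol f g] is half the
    number of roots of [f] and [g] together ([vol_roots]).

    Volumes of expressions of [phi] are therefore half-integers, and a smallest
    one exists. In an expression of minimum volume [f] and [g] have no common
    root, since a common linear factor could be cancelled
    ([min_volume_roots_disjoint]). Given two such expressions, [f + g' = f' + g]
    as functions, hence the multisets of roots satisfy the same relation, and
    disjointness forces [f] and [f'] to have the same roots. So [f] and [f']
    differ by an affine function [c + m x] with [m] an integer, and [g] and [g']
    by the same one.

    Finally the dual subdivision depends only on the functions defined by [f]
    and [g], although different polynomials may define the same function: by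
    duality in one variable ([below_envelope]) terms below the envelope do not
    change the lifted polytope, and adding [c + m x] to both functions
    translates it by the vector [(m, 0, c)] ([newt_up_tpencil_shift]). Its
    bounded faces, and their projections, are translated accordingly. *)

Set Implicit Arguments.
Unset Strict Implicit.
Unset Printing Implicit Defensive.

Import Order.TTheory GRing.Theory Num.Theory.
Import numFieldNormedType.Exports.

Local Open Scope classical_set_scope.
Local Open Scope ring_scope.

(** * Envelopes of monomials and their roots *)

Section Envelopes.
Context {R : realType}.
Implicit Types (c d x r : R) (m : int) (p q : int * R) (l : seq (int * R)).
Implicit Types (s : seq R) (F G : R -> R).

Definition mono p x : R := p.2 + p.1%:~R * x.

(** The terms need not be pairwise distinct in exponent, nor all be visible on
    the graph of [F]: the same function has many term lists. *)
Definition envelope l F : Prop :=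
  forall x, (forall p, p \in l -> mono p x <= F x) /\
            (exists2 p, p \in l & mono p x = F x).

(** A product of tropical linear factors: the monomial of coefficient [c] and
    exponent [m] times the factors with roots [s], counted with multiplicity. *)
Definition root_product c m s x : R :=
  c + m%:~R * x + \sum_(r <- s) Num.max x r.

Lemma envelope_uniq l F G : envelope l F -> envelope l G -> F =1 G.
Proof.
move=> hF hG x; apply/eqP; rewrite eq_le.
have [leF [p pl pF]] := hF x; have [leG [q ql qG]] := hG x.
by apply/andP; split; [rewrite -pF leG | rewrite -qG leF].
Qed.

Lemma exists_seq_max (T : eqType) (E : T -> R) (t : seq T) :
  t != [::] -> exists2 u, u \in t & forall v, v \in t -> E v <= E u.
Proof.
elim: t => [//|a t IH] _.
have [->|/IH [u ut umax]] := eqVneq t [::].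
  by exists a; rewrite ?mem_head // => v; rewrite inE => /eqP ->.
have [au|/ltW ua] := leP (E a) (E u).
  exists u; first by rewrite inE ut orbT.
  by move=> v; rewrite inE => /predU1P[->|/umax].
exists a; rewrite ?mem_head // => v; rewrite inE => /predU1P[->//|/umax vu].
exact: le_trans ua.
Qed.

(** Left of [x0], moving a root beyond [x0] down to [x0] only adds a constant:
    the corresponding factor has slope zero there in both positions. *)
Lemma root_product_left x0 c m s x : x <= x0 ->
  root_product c m s x =
  c + \sum_(r <- s) (r - Num.min r x0) + m%:~R * x
    + \sum_(r <- s) Num.max x (Num.min r x0).
Proof.
move=> xx0; rewrite /root_product.
suff -> : \sum_(r <- s) Num.max x r =
    \sum_(r <- s) (r - Num.min r x0) + \sum_(r <- s) Num.max x (Num.min r x0).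
  by lra.
rewrite -big_split /=; apply: eq_bigr => r _.
have [rx0|x0r] := leP r x0; first by lra.
by rewrite max_r ?(le_trans xx0 (ltW x0r)) // max_r //; lra.
Qed.

Lemma capped_roots_right x0 s x : x0 <= x ->
  \sum_(r <- s) Num.max x (Num.min r x0) = (size s)%:R * x.
Proof.
move=> x0x; transitivity (\sum_(r <- s) x).
  apply: eq_bigr => r _; rewrite max_l // ge_min x0x orbT //.
by rewrite big_const_seq count_predT iter_addr_0 mulr_natl.
Qed.

(** Here a line at least as steep as every piece of a product of linear factors
    meets its graph at the abscissa [x0]. Replacing the product by the line
    right of [x0] moves the roots beyond [x0] down to [x0] and adds [j] new roots
    at [x0], where [j] is the excess of the slope of the line over the largest
    slope [m + size s]. *)
Lemma root_product_cut c m s d (k j : nat) x0 x :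
  k = (size s + j)%N ->
  root_product c m s x0 = d + (m + k%:Z)%:~R * x0 ->
  root_product (c + \sum_(r <- s) (r - Num.min r x0) - j%:R * x0) m
     ([seq Num.min r x0 | r <- s] ++ nseq j x0) x =
  if x <= x0 then root_product c m s x else d + (m + k%:Z)%:~R * x.
Proof.
move=> kE E0.
have sumj y : \sum_(r <- nseq j x0) Num.max y r = j%:R * Num.max y x0.
  by rewrite big_nseq iter_addr_0 mulr_natl.
rewrite {1}/root_product big_cat big_map /= sumj.
case: leP => xx0.
  by rewrite (root_product_left _ _ _ xx0); lra.
move: E0; rewrite (root_product_left _ _ _ (lexx x0)).
rewrite (capped_roots_right s (lexx x0)) (capped_roots_right s (ltW xx0)).
have -> : (m + k%:Z)%:~R = m%:~R + (size s)%:R + j%:R :> R.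
  by rewrite kE PoszD !rmorphD /= addrA.
set S := \sum_(r <- s) _ => E0.
by lra.
Qed.

(** The fundamental theorem of tropical algebra: induction on the terms in
    increasing order of exponents, each new term being a line of larger slope
    than the function built so far. *)
Lemma envelope_roots l : l != [::] ->
  sorted (fun p q => p.1 < q.1) l ->
  exists c m s, [/\ envelope l (root_product c m s),
    m = (head (0, 0) l).1 & m + (size s)%:Z = (last (0, 0) l).1].
Proof.
elim/last_ind: l => [//|l q IH] _ sl.
have [l0|lN0] := eqVneq l [::].
  rewrite l0 /=; exists q.2, q.1, [::]; split => //=; last by rewrite addr0.
  move=> x; rewrite /root_product big_nil addr0; split.
    by move=> p; rewrite inE => /eqP ->.
  by exists q; rewrite ?mem_head.
have /IH {IH} : sorted (fun p q => p.1 < q.1) l.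
  apply: subseq_sorted sl; last exact: subseq_rcons.
  by move=> ? ? ?; apply: lt_trans.
move=> /(_ lN0) [c [m [s [env mE sE]]]].
have ltq p : p \in l -> p.1 < q.1.
  move: sl; rewrite -cats1 => sl pl.
  have := sl; rewrite sorted_pairwise; last by move=> ? ? ?; apply: lt_trans.
  rewrite pairwise_cat => /and3P[/allrelP /(_ p q pl) + _ _].
  by rewrite mem_head; exact.
have gap p : p \in l -> 0 < (q.1 - p.1)%:~R :> R.
  by move=> /ltq pq; rewrite ltr0z subr_gt0.
(* [X p] is where the line of the new term [q] overtakes that of [p]; the
   envelope of [l] is overtaken when the last of its terms is. *)
pose X p : R := (p.2 - q.2) / (q.1 - p.1)%:~R.
have XP p x : p \in l -> (mono p x <= mono q x) = (X p <= x).
  move=> /gap g; rewrite /X ler_pdivrMr // /mono.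
  by rewrite rmorphB /=; apply/idP/idP; lra.
have [p0 p0l p0max] := exists_seq_max X lN0.
pose x0 := X p0.
have E0 : root_product c m s x0 = mono q x0.
  have [le_env [p pl pE]] := env x0; apply/eqP; rewrite eq_le -pE XP // p0max //=.
  rewrite pE; apply: le_trans (le_env p0 p0l).
  have /gap g := p0l; move: g.
  rewrite /x0 /X /mono !rmorphB /= => g.
  rewrite le_eqVlt; apply/orP; left; apply/eqP; field.
  by rewrite gt_eqF.
have lastl : last (0, 0) l \in l.
  by case: (l) lN0 => [//|a t] _ /=; exact: mem_last.
have kE : q.1 = m + `|q.1 - m|%N%:Z.
  rewrite gez0_abs; first by lia.
  by have := ltq _ lastl; rewrite -sE; lia.
pose k := `|q.1 - m|%N; have ks : (size s <= k)%N.
  by have := ltq _ lastl; rewrite -sE /k; lia.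
have kj : k = (size s + (k - size s))%N by rewrite subnKC.
move: E0; rewrite {1}/mono kE => E0.
exists (c + \sum_(r <- s) (r - Num.min r x0) - (k - size s)%:R * x0), m,
  ([seq Num.min r x0 | r <- s] ++ nseq (k - size s) x0); split; last first.
- by rewrite last_rcons kE size_cat size_map size_nseq -kj.
- by move: mE; case: (l) lN0.
move=> x; rewrite (root_product_cut x kj E0).
have [le_env [p pl pE]] := env x.
case: leP => xx0; split.
- move=> p'; rewrite mem_rcons inE => /predU1P[->|/le_env//].
  rewrite -pE leNgt; apply/negP => lt.
  have := ltW lt; rewrite XP // => Xpx.
  have : mono p0 x <= mono p x by rewrite pE; exact: le_env.
  move/le_trans => /(_ _ (ltW lt)); rewrite XP // => X0x.
  have xE : x = x0 by apply/eqP; rewrite eq_le xx0 X0x.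
  by move: lt; rewrite pE xE E0 /mono -kE ltxx.
- by exists p; rewrite // mem_rcons inE pl orbT.
- move=> p'; rewrite mem_rcons inE => /predU1P[->|p'l]; first by rewrite /mono -kE.
  by rewrite -kE -[leRHS]/(mono q x) XP // (le_trans (p0max _ p'l)) // ltW.
- by exists q; [rewrite mem_rcons mem_head | rewrite /mono -kE].
Qed.

(** Multiplying by the factor of root [r] adds a copy of the term list with
    coefficients shifted by [r] to a copy with exponents shifted by one. *)
Lemma roots_envelope c m s : exists l, envelope l (root_product c m s).
Proof.
elim: s => [|r s [l env]].
  exists [:: (m, c)] => x; rewrite /root_product big_nil addr0; split.
    by move=> p; rewrite inE => /eqP ->.
  by exists (m, c); rewrite ?mem_head.
exists ([seq (p.1, p.2 + r) | p <- l] ++ [seq (p.1 + 1, p.2) | p <- l]) => x.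
have E1 p : mono (p.1, p.2 + r) x = mono p x + r by rewrite /mono /=; lra.
have E2 p : mono (p.1 + 1, p.2) x = mono p x + x.
  by rewrite /mono /= rmorphD /=; lra.
have -> : root_product c m (r :: s) x = root_product c m s x + Num.max x r.
  by rewrite /root_product big_cons; lra.
have [le_env [p pl pE]] := env x; split.
  move=> q; rewrite mem_cat => /orP[] /mapP[p' /le_env p'x ->].
    by rewrite E1 lerD // le_max lexx orbT.
  by rewrite E2 lerD // le_max lexx.
have [xr|rx] := leP x r.
  exists (p.1, p.2 + r); rewrite ?E1 ?pE //.
  by rewrite mem_cat; apply/orP; left; apply/mapP; exists p.
exists (p.1 + 1, p.2); rewrite ?E2 ?pE //.
by rewrite mem_cat; apply/orP; right; apply/mapP; exists p.
Qed.

(** For a small step [e], the second difference of a piecewise linear function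
    at [x] is [e] times its change of slope there, which detects roots without
    any appeal to one-sided derivatives. *)
Definition second_difference (e : R) F x := F (x + e) + F (x - e) - 2 * F x.

Lemma second_difference_max e r x : 0 < e -> (r == x) || (e <= `|r - x|) ->
  second_difference e (fun y => Num.max y r) x = e *+ (r == x).
Proof.
move=> e0; rewrite /second_difference.
have [->|rx] /= := eqVneq r x.
  by move=> _; rewrite max_l ?max_r ?maxxx; lra.
rewrite ler_normr => /orP[]h.
  by rewrite !max_r /=; lra.
by rewrite !max_l /=; lra.
Qed.

Lemma second_difference_root_product c m s x e : 0 < e ->
  (forall r, r \in s -> (r == x) || (e <= `|r - x|)) ->
  second_difference e (root_product c m s) x = e *+ count_mem x s.
Proof.
move=> e0 sep; transitivity
  (\sum_(r <- s) second_difference e (fun y => Num.max y r) x).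
  rewrite /second_difference /root_product !big_split /= sumrN -mulr_sumr.
  by lra.
rewrite big_seq (eq_bigr (fun r => e *+ (r == x))); last first.
  by move=> r rs; rewrite second_difference_max // sep.
by rewrite -big_seq sumrMnr -sum1_count [in RHS]big_mkcond.
Qed.

Lemma separation s x :
  exists2 e : R, 0 < e & forall r, r \in s -> (r == x) || (e <= `|r - x|).
Proof.
elim: s => [|a s [e e0 sep]]; first by exists 1.
have [ax|ax] := eqVneq a x.
  by exists e => // r; rewrite inE => /predU1P[->|/sep//]; rewrite ax eqxx.
exists (Num.min e `|a - x|); first by rewrite lt_min e0 normr_gt0 subr_eq0.
move=> r; rewrite inE => /predU1P[->|/sep/orP[->//|h]].
  by rewrite ge_min lexx !orbT.
by rewrite ge_min h !orbT.
Qed.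

(** The multiplicity of a root is the change of slope of the function there,
    so the function determines the multiset of roots. *)
Lemma root_product_roots c m s c' m' s' :
  root_product c m s =1 root_product c' m' s' -> perm_eq s s'.
Proof.
move=> E; apply/allP => x _ /=.
have [e e0 sep] := separation (s ++ s') x.
have sdE : second_difference e (root_product c m s) x =
           second_difference e (root_product c' m' s') x.
  by rewrite /second_difference !E.
have seps r : r \in s -> (r == x) || (e <= `|r - x|).
  by move=> rs; apply: sep; rewrite mem_cat rs.
have seps' r : r \in s' -> (r == x) || (e <= `|r - x|).
  by move=> rs; apply: sep; rewrite mem_cat rs orbT.
rewrite (second_difference_root_product _ _ e0 seps) in sdE.
rewrite (second_difference_root_product _ _ e0 seps') in sdE.
apply/eqP/(mulrIn (lt0r_neq0 e0)); exact: sdE.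
Qed.

Lemma root_product_perm c m s s' :
  perm_eq s s' -> root_product c m s =1 root_product c m s'.
Proof. by move=> ss' x; rewrite /root_product (perm_big _ ss'). Qed.

Lemma root_productM c m s c' m' s' x :
  root_product c m s x + root_product c' m' s' x =
  root_product (c + c') (m + m') (s ++ s') x.
Proof. by rewrite /root_product big_cat /= rmorphD /=; lra. Qed.

End Envelopes.

(** * Univariate tropical polynomials as lists of terms *)

Section Terms.
Context {R : realType}.
Implicit Types (f g : tpoly R 1) (F : R -> R).

Definition terms f : seq (int * R) :=
  [seq ((i : 'rV[int]_1) 0 0, odflt 0 f.[? i]%fmap) | i <- domf f].

Lemma row1P (T : Type) (i : 'rV[T]_1) : const_mx (i 0 0) = i.
Proof. by apply/rowP => k; rewrite mxE !ord1. Qed.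

Lemma mem_terms f (i : int) (c : R) :
  (i, c) \in terms f = (tcoef f (const_mx i) == c%:E).
Proof.
rewrite /tcoef; apply/mapP/idP => [[j jf [-> ->]]|].
  by rewrite row1P in_fnd.
case: fndP => // jf /eqP[<-]; exists (const_mx i) => //.
by rewrite mxE in_fnd.
Qed.

Lemma terms_uniq f : uniq [seq p.1 | p <- terms f].
Proof.
rewrite -map_comp map_inj_uniq ?fset_uniq // => i j /= ij.
by rewrite -(row1P i) ij row1P.
Qed.

Lemma terms_eq0 f : (terms f == [::]) = (f == @tzero R 1).
Proof.
apply/idP/idP => [|/eqP ->]; last first.
  rewrite -size_eq0 size_map -[size _]/(#|` domf (@tzero R 1)|)%fset.
  by rewrite cardfs_eq0 domf0.
move=> /eqP/(congr1 size)/eqP.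
rewrite size_map -[size _]/(#|` domf f|)%fset cardfs_eq0 => /eqP f0.
apply/eqP/fmapP => k; rewrite /tzero fnd_fmap0.
have kf : k \notin domf f by rewrite f0 inE.
exact: not_fnd kf.
Qed.

Lemma teval_envelope f F : envelope (terms f) F ->
  forall t : 'rV[R]_1, teval f t = (F (t 0 0))%:E.
Proof.
move=> env t; have [le_env [[i c] pl pE]] := env (t 0 0).
have term j : j \in domf f -> exists2 d, (j 0 0, d) \in terms f &
    (tcoef f j + (dotr (zvec j) t)%:E)%E = (mono (j 0 0, d) (t 0 0))%:E.
  move=> jf; exists f.[jf]%fmap.
    by rewrite mem_terms row1P /tcoef in_fnd.
  by rewrite /tcoef in_fnd /dotr big_ord1 /zvec !mxE.
apply/le_anti/andP; split.
  rewrite /teval big_seq_cond; apply: bigmax_le; first exact: leNye.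
  by move=> j; rewrite andbT => /term[d dl ->]; rewrite lee_fin le_env.
have idom : const_mx i \in domf f.
  by move: pl; rewrite mem_terms /tcoef; case: fndP.
have [d dl dE] := term _ idom.
rewrite -pE; move: dl dE; rewrite mxE => dl dE.
have -> : c = d.
  by move: pl dl; rewrite !mem_terms => /eqP -> /eqP[].
rewrite -dE /teval.
exact: (@Order.TotalTheory.le_bigmax_seq _ _ _ _ -oo%E _ xpredT
  (fun j => (tcoef f j + (dotr (zvec j) t)%:E)%E) idom isT).
Qed.

Definition exponent_range f (a b : int) : Prop :=
  [/\ exists c, (a, c) \in terms f, exists c, (b, c) \in terms f &
      forall p, p \in terms f -> a <= p.1 <= b].

Lemma envelope_eqmem (l l' : seq (int * R)) F :
  l =i l' -> envelope l F -> envelope l' F.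
Proof.
move=> ll' env x; have [le_env [p pl pE]] := env x; split.
  by move=> q; rewrite -ll'; exact: le_env.
by exists p; rewrite -?ll'.
Qed.

(** The Newton interval starts at the exponent of the monomial factor and its
    length is the number of roots. *)
Lemma tpoly_roots f : f <> @tzero R 1 ->
  exists c m s, envelope (terms f) (root_product c m s) /\
                exponent_range f m (m + (size s)%:Z).
Proof.
move=> /eqP; rewrite -terms_eq0 => f0.
pose l := sort (fun p q : int * R => p.1 <= q.1) (terms f).
have lE : l =i terms f by move=> p; rewrite mem_sort.
have l0 : l != [::].
  apply: contra f0 => /eqP l0.
  by rewrite -size_eq0 -(size_sort (fun p q : int * R => p.1 <= q.1)) -/l l0.
have le_trans1 : transitive (fun p q : int * R => p.1 <= q.1).
  by move=> ? ? ?; exact: le_trans.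
have sl : sorted (fun p q : int * R => p.1 <= q.1) l.
  by apply: sort_sorted => p q; exact: le_total.
have lt_l : sorted (fun p q : int * R => p.1 < q.1) l.
  rewrite -[sorted _ l](@sorted_map _ _ fst <%R l).
  rewrite lt_sorted_uniq_le sorted_map sl andbT.
  by rewrite (perm_uniq (perm_map _ (permEl (perm_sort _ _)))) terms_uniq.
have [c [m [s [env mE sE]]]] := envelope_roots l0 lt_l.
exists c, m, s; split; first exact: envelope_eqmem env.
have headl : head (0, 0) l \in l by case: (l) l0 => // a t _; exact: mem_head.
have lastl : last (0, 0) l \in l by case: (l) l0 => // a t _ /=; exact: mem_last.
split.
- by exists (head (0, 0) l).2; rewrite mE -surjective_pairing -lE.
- by exists (last (0, 0) l).2; rewrite sE -surjective_pairing -lE.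
move=> p; rewrite -lE sE mE => pl; apply/andP; split.
  case: (l) sl pl => // a t /= sl; rewrite inE => /predU1P[->//|].
  by move: sl; rewrite (path_sortedE le_trans1) => /andP[/allP le_a _] /le_a.
case/lastP: (l) sl pl => // t a; rewrite last_rcons mem_rcons inE.
rewrite -cats1 (sorted_pairwise le_trans1) pairwise_cat => /and3P[/allrelP at_ _ _].
by move=> /predU1P[->//|pt]; apply: at_; rewrite ?mem_head.
Qed.

(** A list may repeat an exponent; keeping the largest coefficient for each
    exponent gives a polynomial with the same envelope. *)
Lemma list_tpoly (l : seq (int * R)) : exists f,
  {subset terms f <= l} /\
  forall p, p \in l -> exists2 q, q \in terms f & q.1 = p.1 /\ p.2 <= q.2.
Proof.
elim: l => [|[i c] l [f [fl lf]]].
  exists (@tzero R 1); split=> [p|//].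
  have /eqP -> // : terms (@tzero R 1) == [::] by rewrite terms_eq0.
have add_in q : q \in terms f -> q \in (i, c) :: l.
  by move=> /fl ql; rewrite inE ql orbT.
have [[d dlt]|noc] := pselect (exists2 d, (i, d) \in terms f & c <= d).
  exists f; split=> // p; rewrite inE => /predU1P[->|/lf//].
  by exists (i, d).
pose g : tpoly R 1 := f.[const_mx i <- c]%fmap.
have gE j d : (j, d) \in terms g = if j == i then d == c else (j, d) \in terms f.
  rewrite mem_terms /tcoef fnd_set.
  have -> : (const_mx j == const_mx i :> 'rV[int]_1) = (j == i).
    by apply/eqP/eqP => [/matrixP/(_ 0 0)|->//]; rewrite !mxE.
  by have [_|_] := eqVneq j i; [rewrite eqe eq_sym | rewrite mem_terms /tcoef].
exists g; split.
  move=> [j d]; rewrite gE; case: eqP => [-> /eqP ->|_ /add_in //].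
  by rewrite mem_head.
move=> [j d]; rewrite inE => /predU1P[[-> ->]|].
  by exists (i, c); rewrite // gE !eqxx.
move=> /lf[[j' d'] + /= [jj' dd']]; rewrite {j'}jj' => qf.
have [ji|ji] := eqVneq j i.
  exists (j, c); first by rewrite gE ji !eqxx.
  split=> //=.
  apply: le_trans dd' _; rewrite leNgt; apply/negP => /ltW cd.
  by apply: noc; exists d'; rewrite // -ji.
by exists (j, d'); rewrite // gE (negbTE ji).
Qed.

Lemma root_product_tpoly c m s : exists f,
  f <> @tzero R 1 /\ envelope (terms f) (root_product c m s).
Proof.
have [l env] := roots_envelope c m s; have [f [fl lf]] := list_tpoly l.
exists f; split.
  move=> /eqP; rewrite -terms_eq0 => /eqP f0.
  by have [_ [p /lf[q]]] := env 0; rewrite f0.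
move=> x; have [le_env [p pl pE]] := env x.
split=> [q /fl/le_env//|]; have [q qf [qp pq]] := lf p pl.
exists q => //; apply/le_anti; rewrite le_env ?fl //= -pE.
by rewrite /mono qp lerD2r.
Qed.

End Terms.

(** * The lifted polytope of a pencil *)

Section Pencils.
Context {R : realType}.

Lemma tcoef_notin n (f : tpoly R n) i : i \notin domf f -> tcoef f i = -oo%E.
Proof. by move=> /not_fnd fi; rewrite /tcoef fi. Qed.

Lemma tcoef_tpoly_of n S (c : 'rV[int]_n -> \bar R) i :
  (i \notin S -> c i = -oo%E) -> c i != +oo%E -> tcoef (tpoly_of S c) i = c i.
Proof.
move=> cS cy; rewrite /tcoef /tpoly_of.
case: fndP => [iS|].
  rewrite ffunE /= fineK //; move: iS; by rewrite !inE => /andP[].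
rewrite !inE /= negb_and => /orP[/cS ->//|].
by case: (c i) cy.
Qed.

Lemma tcoef_neqy n (f : tpoly R n) i : tcoef f i != +oo%E.
Proof. by rewrite /tcoef; case: fndP. Qed.

Lemma tcoef_tadd n (f g : tpoly R n) i :
  tcoef (tadd f g) i = Order.max (tcoef f i) (tcoef g i).
Proof.
rewrite /tadd tcoef_tpoly_of // => [|].
  by rewrite inE negb_or => /andP[fi gi]; rewrite !tcoef_notin // maxxx.
by rewrite maxEle; case: ifP => _; exact: tcoef_neqy.
Qed.

Lemma tcoef_tlift n (f : tpoly R n) k :
  tcoef (tlift f) k = if rsubmx k == 0 then tcoef f (lsubmx k) else -oo%E.
Proof.
rewrite /tlift tcoef_tpoly_of //; last by case: ifP => // _; exact: tcoef_neqy.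
case: eqP => // k0 kS; apply: tcoef_notin; apply: contra kS => kf.
by apply/imfsetP; exists (lsubmx k) => //=; rewrite -k0 hsubmxK.
Qed.

Lemma tcoef_tmul_lastvar n (f : tpoly R (n + 1)) k :
  tcoef (tmul (tlastvar n) f) k = tcoef f (k - row_mx 0 (const_mx 1)).
Proof.
set e := row_mx _ _.
have lastE : (domf (tlastvar n : tpoly R (n + 1)) = [fset e])%fset.
  by rewrite /tlastvar dom_setf domf0 fsetU0.
have bigE : \big[Order.max/-oo%E]_(i <- domf (tlastvar n : tpoly R (n + 1)))
    (tcoef (tlastvar n : tpoly R (n + 1)) i + tcoef f (k - i)%R)%E =
    tcoef f (k - e).
  rewrite lastE big_seq_fset1 /tcoef fnd_set eqxx add0e //.
rewrite /tmul tcoef_tpoly_of; first exact: bigE.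
  move=> kS; rewrite bigE; apply: tcoef_notin; apply: contra kS => kf.
  apply/imfset2P; exists e; first by rewrite lastE inE.
  by exists (k - e) => //; rewrite addrC subrK.
by rewrite bigE tcoef_neqy.
Qed.

Lemma tcoef_tpencil n (f g : tpoly R n) k :
  tcoef (tpencil f g) k =
  if rsubmx k == 0 then tcoef f (lsubmx k)
  else if rsubmx k == const_mx 1 then tcoef g (lsubmx k) else -oo%E.
Proof.
rewrite /tpencil tcoef_tadd tcoef_tmul_lastvar !tcoef_tlift.
have -> : rsubmx (k - row_mx 0 (const_mx 1)) = rsubmx k - const_mx 1.
  by rewrite linearB /= row_mxKr.
have -> : lsubmx (k - row_mx 0 (const_mx 1)) = lsubmx k.
  by rewrite linearB /= row_mxKl subr0.
rewrite subr_eq0; case: eqP => [->|_].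
  case: eqP => [/matrixP/(_ 0 0)|_]; first by rewrite !mxE.
  by rewrite max_l ?leNye.
by rewrite max_r ?leNye.
Qed.

Lemma convex_setP n (A : set 'rV[R]_n) : convex_set A <->
  forall x y t, 0 <= t <= 1 -> A x -> A y -> A (t *: x + (1 - t) *: y).
Proof.
split=> [cA x y t /andP[t0 t1] Ax Ay|cA x y t].
  have t01 : Itv.spec (@Itv.num_sem R) (Itv.Real `[0, 1]%Z) t.
    by rewrite /= /Itv.num_sem /= num_real in_itv /= t0 t1.
  by have := cA x y (Itv.Def t01); rewrite !inE; exact.
rewrite !inE => Ax Ay; apply: cA => //.
by apply/andP; split.
Qed.

Lemma conv_hull_sub n (A : set 'rV[R]_n) : A `<=` conv_hull A.
Proof. exact: sub_gen_smallest. Qed.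

Lemma conv_hull_min n (A C : set 'rV[R]_n) :
  convex_set C -> A `<=` C -> conv_hull A `<=` C.
Proof. exact: smallest_sub. Qed.

Lemma conv_hull_convex n (A : set 'rV[R]_n) : convex_set (conv_hull A).
Proof.
apply/convex_setP => x y t t01 Ax Ay C [/= cC AC].
by have /convex_setP := cC; apply => //; [apply: Ax|apply: Ay].
Qed.

Lemma convex_set_shift n (A : set 'rV[R]_n) w :
  convex_set A -> convex_set [set v | A (v - w)].
Proof.
move=> /convex_setP cA; apply/convex_setP => x y t t01 /= Ax Ay.
have -> : t *: x + (1 - t) *: y - w = t *: (x - w) + (1 - t) *: (y - w).
  by rewrite !scalerBr addrACA -opprD -scalerDl addrC subrKC scale1r addrC.
exact: cA.
Qed.

(** Conjugate duality in one variable: if the line of slope [i] and height [a]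
    stays below the envelope, then [(i, a)] lies below a segment joining two
    points of the term list. Each term [p] dominates the line on a half-line
    ending at [u p], unbounded to the left or to the right according to whether
    its exponent is smaller or larger than [i]. Unless a term of exponent [i]
    is at least as high as [a], these half-lines cover the real axis, so two
    opposite ones meet, and they give the segment. *)
Lemma below_envelope (l : seq (int * R)) F (i a : R) : envelope l F ->
  (forall x, a + i * x <= F x) ->
  exists p q t, [/\ p \in l, q \in l, 0 <= t <= 1,
    i = t * p.1%:~R + (1 - t) * q.1%:~R & a <= t * p.2 + (1 - t) * q.2].
Proof.
move=> env below.
have [[p pl [pi ap]]|noeq] :=
    pselect (exists2 p, p \in l & p.1%:~R = i /\ a <= p.2).
  by exists p, p, 1; rewrite pi; split => //; [rewrite lexx ler01| lra|lra].
pose u (p : int * R) : R := (p.2 - a) / (i - p.1%:~R).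
pose l1 := [seq p <- l | p.1%:~R < i]; pose l2 := [seq p <- l | i < p.1%:~R].
have [[p [q [p1 q2 qp]]]|nopair] :=
    pselect (exists p q, [/\ p \in l1, q \in l2 & u q <= u p]).
  move: p1 q2; rewrite !mem_filter => /andP[pi pl] /andP[iq ql].
  exists p, q, ((q.1%:~R - i) / (q.1%:~R - p.1%:~R)).
  have gap : 0 < q.1%:~R - p.1%:~R :> R by rewrite subr_gt0 (lt_trans pi).
  have gapN : q.1%:~R - p.1%:~R != 0 :> R by rewrite gt_eqF.
  split => //.
  - by apply/andP; split; [apply: divr_ge0; lra | rewrite ler_pdivrMr //; lra].
  - by field.
  have -> : (q.1%:~R - i) / (q.1%:~R - p.1%:~R) * p.2 +
     (1 - (q.1%:~R - i) / (q.1%:~R - p.1%:~R)) * q.2 =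
     ((q.1%:~R - i) * p.2 + (i - p.1%:~R) * q.2) / (q.1%:~R - p.1%:~R).
    by field.
  rewrite ler_pdivlMr //.
  move: qp; rewrite /u -[i - q.1%:~R]opprB invrN mulrN -mulNr opprB.
  rewrite ler_pdivrMr ?subr_gt0 // mulrAC ler_pdivlMr ?subr_gt0 //.
  by lra.
(* If no two opposite half-lines met, some [x0] would lie in none of them. *)
have [x0 x1 x2] : exists2 x0, (forall p, p \in l1 -> u p < x0) &
    (forall q, q \in l2 -> x0 < u q).
  have [l10|/(exists_seq_max u)[p p1 pmax]] := eqVneq l1 [::].
    have [l20|/(exists_seq_max (fun q => - u q))[q q2 qmin]] := eqVneq l2 [::].
      by exists 0; rewrite ?l10 ?l20.
    exists (u q - 1); rewrite ?l10 // => q' /qmin; lra.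
  have [l20|/(exists_seq_max (fun q => - u q))[q q2 qmin]] := eqVneq l2 [::].
    by exists (u p + 1); rewrite ?l20 // => p' /pmax; lra.
  have pq : u p < u q.
    by rewrite ltNge; apply/negP => qp; apply: nopair; exists p, q.
  exists ((u p + u q) / 2) => [p' /pmax|q' /qmin]; lra.
have [_ [p pl pE]] := env x0; have := below x0; rewrite -pE /mono.
have [pi|ip|pi] := ltgtP p.1%:~R i.
- have : p \in l1 by rewrite mem_filter pi.
  move=> /x1; rewrite /u ltr_pdivrMr ?subr_gt0 //; lra.
- have : p \in l2 by rewrite mem_filter ip.
  move=> /x2; rewrite /u -[i - _]opprB invrN mulrN -mulNr opprB.
  by rewrite ltr_pdivlMr ?subr_gt0 //; lra.
by rewrite pi lerD2r => ap; case: noeq; exists p.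
Qed.

Definition pt (x y : R) : 'rV[R]_(1 + 1) := row_mx (const_mx x) (const_mx y).

Lemma ptE (v : 'rV[R]_(1 + 1)) : exists x y, v = pt x y.
Proof.
exists (lsubmx v 0 0), (rsubmx v 0 0).
by rewrite /pt !row1P hsubmxK.
Qed.

Lemma pt_comb x y x' y' t : t *: pt x y + (1 - t) *: pt x' y' =
  pt (t * x + (1 - t) * x') (t * y + (1 - t) * y').
Proof.
rewrite /pt !scale_row_mx add_row_mx; congr row_mx.
  by apply/rowP => i; rewrite !mxE.
by apply/rowP => i; rewrite !mxE.
Qed.

(** Exponent in [x], exponent in [y], height. *)
Definition pt3 (x y z : R) : 'rV[R]_(1 + 1 + 1) := row_mx (pt x y) (const_mx z).

Lemma pt3_comb x y z x' y' z' t : t *: pt3 x y z + (1 - t) *: pt3 x' y' z' =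
  pt3 (t * x + (1 - t) * x') (t * y + (1 - t) * y') (t * z + (1 - t) * z').
Proof.
rewrite /pt3 -pt_comb !scale_row_mx add_row_mx; congr row_mx.
by apply/rowP => i; rewrite !mxE.
Qed.

Lemma pt3D x y z x' y' z' : pt3 x y z + pt3 x' y' z' =
  pt3 (x + x') (y + y') (z + z').
Proof.
rewrite /pt3 /pt !add_row_mx; congr row_mx; first congr row_mx.
all: by apply/rowP => i; rewrite !mxE.
Qed.

Lemma pt3N x y z : - pt3 x y z = pt3 (- x) (- y) (- z).
Proof.
rewrite /pt3 /pt !opp_row_mx; congr row_mx; first congr row_mx.
all: by apply/rowP => i; rewrite !mxE.
Qed.

Lemma below_envelope_pt3 (A : set 'rV[R]_(1 + 1 + 1)) (l : seq (int * R)) F y :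
  convex_set A ->
  (forall p a, p \in l -> a <= p.2 -> A (pt3 p.1%:~R y a)) ->
  envelope l F ->
  forall i a, (forall x, a + i * x <= F x) -> A (pt3 i y a).
Proof.
move=> /convex_setP cA lA env i a below.
have [p [q [t [pl ql t01 -> ale]]]] := below_envelope env below.
set d := t * p.2 + (1 - t) * q.2 - a.
have d0 : 0 <= d by rewrite subr_ge0.
have := cA _ _ _ t01 (lA _ (p.2 - d) pl _) (lA _ (q.2 - d) ql _).
rewrite pt3_comb; have -> : t * y + (1 - t) * y = y by lra.
have -> : t * (p.2 - d) + (1 - t) * (q.2 - d) = a by rewrite /d; lra.
by apply; rewrite lerBlDr lerDl.
Qed.

Lemma zvec_row_mx (i : 'rV[int]_(1 + 1)) :
  zvec i = pt (lsubmx i 0 0)%:~R (rsubmx i 0 0)%:~R.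
Proof.
by rewrite -[i in LHS]hsubmxK /zvec map_row_mx /pt; congr row_mx;
  apply/rowP => k; rewrite !mxE !ord1.
Qed.

Lemma tpencil_generator (f g : tpoly R 1) (p : int * R) :
  (p \in terms f ->
   tcoef (tpencil f g) (row_mx (const_mx p.1) (const_mx 0)) = p.2%:E) /\
  (p \in terms g ->
   tcoef (tpencil f g) (row_mx (const_mx p.1) (const_mx 1)) = p.2%:E).
Proof.
rewrite !tcoef_tpencil row_mxKr row_mxKl eqxx row_mxKr row_mxKl eqxx.
have -> : (const_mx 1 == 0 :> 'rV[int]_1) = false.
  by apply/eqP => /matrixP/(_ 0 0); rewrite !mxE.
by rewrite {1 4}[p]surjective_pairing !mem_terms; split=> /eqP.
Qed.

Lemma tpencil_termP (f g : tpoly R 1) k (a : R) :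
  (a%:E <= tcoef (tpencil f g) k)%E ->
  exists2 p, a <= p.2 &
    p \in terms f /\ k = row_mx (const_mx p.1) (const_mx 0) \/
    p \in terms g /\ k = row_mx (const_mx p.1) (const_mx 1).
Proof.
rewrite tcoef_tpencil.
have term (h : tpoly R 1) : (a%:E <= tcoef h (lsubmx k))%E ->
    exists2 p, a <= p.2 & p \in terms h /\ lsubmx k = const_mx p.1.
  case E : (tcoef h (lsubmx k)) (tcoef_neqy h (lsubmx k)) => [c| |] //.
  rewrite lee_fin => _ ac; exists (lsubmx k 0 0, c) => //=.
  by rewrite mem_terms row1P E.
case: eqP => [k0 /term[p ap [pf kE]]|_].
  by exists p => //; left; rewrite -kE -[const_mx 0]k0 hsubmxK.
case: eqP => // k1 /term[p ap [pf kE]].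
by exists p => //; right; rewrite -kE -k1 hsubmxK.
Qed.

(** A generator of the left-hand polytope, whether or not its term is visible
    on the graph of [F] or [G], gives a line below that graph. After translation
    it is below the graph of [F'] or [G'], and [below_envelope] puts the point in
    the other polytope. Exchanging the two pairs gives the reverse inclusion. *)
Lemma newt_up_tpencil_shift (f g f' g' : tpoly R 1) F G F' G'
    (c : R) (m : int) :
  envelope (terms f) F -> envelope (terms g) G ->
  envelope (terms f') F' -> envelope (terms g') G' ->
  (forall x, F x = F' x + (c + m%:~R * x)) ->
  (forall x, G x = G' x + (c + m%:~R * x)) ->
  newt_up (tpencil f g) `<=`
  [set v | newt_up (tpencil f' g') (v - pt3 m%:~R 0 c)].
Proof.
move=> envf envg envf' envg' FF' GG'.
apply: conv_hull_min.
  by apply: convex_set_shift; exact: conv_hull_convex.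
have gen (h : tpoly R 1) y : (forall p, p \in terms h ->
    tcoef (tpencil f' g') (row_mx (const_mx p.1) (const_mx y)) = p.2%:E) ->
    forall p a, p \in terms h -> a <= p.2 ->
    newt_up (tpencil f' g') (pt3 p.1%:~R y%:~R a).
  move=> hy p a ph ap; apply: conv_hull_sub.
  exists (row_mx (const_mx p.1) (const_mx y)), a; rewrite hy // lee_fin; split => //.
  by rewrite zvec_row_mx row_mxKl row_mxKr !mxE.
move=> v [k [a [/tpencil_termP[p ap kE] ->]]] /=.
rewrite pt3N.
case: kE => [[pf ->]|[pf ->]];
  rewrite zvec_row_mx row_mxKl row_mxKr !mxE -/(pt3 _ _ _) pt3D oppr0 addr0.
- apply: (below_envelope_pt3 (A := newt_up (tpencil f' g')) (@conv_hull_convex _ _)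
    (gen f' 0 (fun p => (tpencil_generator f' g' p).1)) envf') => x.
  have [/(_ p pf) + _] := envf x; rewrite FF' /mono; lra.
- apply: (below_envelope_pt3 (A := newt_up (tpencil f' g')) (@conv_hull_convex _ _)
    (gen g' 1 (fun p => (tpencil_generator f' g' p).2)) envg') => x.
  have [/(_ p pf) + _] := envg x; rewrite GG' /mono; lra.
Qed.

End Pencils.

(** * Translations of dual subdivisions *)

Section Translation.
Context {R : realType}.

Definition translate n (w : 'rV[R]_n) (A : set 'rV[R]_n) : set 'rV[R]_n :=
  [set x + w | x in A].

Lemma translateK n (w : 'rV[R]_n) A : translate (- w) (translate w A) = A.
Proof.
rewrite /translate image_comp -[RHS]image_id; apply: eq_imagel => x _ /=.
by rewrite addrK.
Qed.

(** Inclusions after translation in both directions give equality, so that a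
    one-sided lemma about hulls can be used twice. *)
Lemma translate_subP n (w : 'rV[R]_n) A B :
  B `<=` [set v | A (v - w)] -> A `<=` [set v | B (v - - w)] ->
  B = translate w A.
Proof.
move=> BA AB; apply/seteqP; split => [x /BA Ax|_ [x /AB + <-]].
  by exists (x - w); rewrite ?subrK.
by rewrite /= opprK.
Qed.

Lemma dotrDr n (u x y : 'rV[R]_n) : dotr u (x + y) = dotr u x + dotr u y.
Proof.
by rewrite /dotr -big_split; apply: eq_bigr => k _; rewrite mxE mulrDr.
Qed.

Lemma face_translate n (w : 'rV[R]_n) P F :
  face P F -> face (translate w P) (translate w F).
Proof.
move=> [[x Fx] [u FE]]; split; first by exists (x + w), x.
exists u; rewrite {Fx}FE; apply/seteqP; split.
  move=> _ [y [Py ymax] <-]; split; first by exists y.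
  by move=> _ [z Pz <-]; rewrite !dotrDr lerD2r ymax.
move=> _ [[y Py <-] ymax]; exists y => //; split => // z Pz.
by rewrite -(lerD2r (dotr u w)) -!dotrDr; apply: ymax; exists z.
Qed.

Lemma bounded_translate n (w : 'rV[R]_n) (F : set 'rV[R]_n) :
  bounded_set F -> bounded_set (translate w F).
Proof.
move=> [M [_ FM]]; exists (M + `|w|); split; first exact: num_real.
move=> N MN _ [x Fx <-] /=; apply: le_trans (ler_normD _ _) _.
by rewrite -lerBrDr; apply: (FM (N - `|w|)) => //; rewrite ltrBrDr.
Qed.

Lemma lsubmx_translate n (w : 'rV[R]_(n + 1)) F :
  lsubmx @` translate w F = translate (lsubmx w) (lsubmx @` F).
Proof.
rewrite /translate !image_comp; apply: eq_imagel => x _ /=.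
by rewrite linearD.
Qed.

Lemma dual_subdivision_translate n (f g : tpoly R n) w :
  newt_up f = translate w (newt_up g) ->
  forall C, dual_subdivision g C -> dual_subdivision f (translate (lsubmx w) C).
Proof.
move=> fg _ [F [gF bF] <-]; exists (translate w F).
  by split; [rewrite fg; exact: face_translate | exact: bounded_translate].
exact: lsubmx_translate.
Qed.

Lemma translation_of_newt_up n (f g : tpoly R n) w :
  newt_up f = translate w (newt_up g) ->
  translation_of (dual_subdivision f) (dual_subdivision g).
Proof.
move=> fg; exists (lsubmx w).
have gf : newt_up g = translate (- w) (newt_up f) by rewrite fg translateK.
apply/seteqP; split => [C fC|_ [C gC <-]]; last exact: (dual_subdivision_translate fg).
exists (translate (- lsubmx w) C).
  by have := dual_subdivision_translate gf fC; rewrite linearN.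
by rewrite -[RHS](translateK (- lsubmx w)) opprK.
Qed.

End Translation.

(** * The volume of a pair *)

Section Volume.
Context {R : realType}.
Implicit Types (f g : tpoly R 1).

Lemma segmentP (P Q x : R) : P <= x <= Q ->
  exists2 t, 0 <= t <= 1 & x = t * P + (1 - t) * Q.
Proof.
move=> /andP[Px xQ]; have [PQ|PQ] := eqVneq P Q.
  by exists 1; [rewrite lexx ler01 | lra].
have PQ0 : 0 < Q - P by rewrite subr_gt0 lt_neqAle PQ (le_trans Px).
exists ((Q - x) / (Q - P)); last by field; rewrite gt_eqF.
by apply/andP; split; [apply: divr_ge0; lra | rewrite ler_pdivrMr //; lra].
Qed.

Definition trapezoid (a b a' b' : R) : set (R * R) :=
  [set p | [/\ 0 <= p.2, p.2 <= 1,
     (1 - p.2) * a + p.2 * a' <= p.1 & p.1 <= (1 - p.2) * b + p.2 * b']].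

Lemma pt_inj x y x' y' : pt x y = pt x' y' :> 'rV[R]_(1 + 1) -> x = x' /\ y = y'.
Proof.
by move=> /eq_row_mx[/matrixP/(_ 0 0) + /matrixP/(_ 0 0)]; rewrite !mxE.
Qed.

(** The generators lie at heights 0 and 1, inside the Newton intervals of [f]
    and [g]; conversely the four vertices are generators, and every point of the
    trapezoid is on a horizontal segment between its two slanted sides. *)
Lemma newt_tpencil f g (a b a' b' : int) :
  exponent_range f a b -> exponent_range g a' b' ->
  [set p : R * R | newt (tpencil f g) (pt p.1 p.2)] =
  trapezoid a%:~R b%:~R a'%:~R b'%:~R.
Proof.
move=> [[ca fa] [cb fb] fab] [[ca' ga] [cb' gb] gab].
apply/seteqP; split.
  pose C := [set v : 'rV[R]_(1 + 1) | forall p, v = pt p.1 p.2 ->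
    trapezoid a%:~R b%:~R a'%:~R b'%:~R p].
  suff NC : newt (tpencil f g) `<=` C by move=> p /NC; exact.
  apply: conv_hull_min.
    apply/convex_setP => v v' t /andP[t0 t1].
    have [x [y ->]] := ptE v; have [x' [y' ->]] := ptE v'.
    move=> Cv Cv' [px py]; rewrite pt_comb => /pt_inj /= [<- <-].
    have [/= y0 y1 x0 x1] := Cv (x, y) erefl.
    have [/= y0' y1' x0' x1'] := Cv' (x', y') erefl.
    have T (u u' : R) : 0 <= u -> 0 <= u' -> 0 <= t * u + (1 - t) * u'.
      by move=> u0 u0'; rewrite addr_ge0 // mulr_ge0 // subr_ge0.
    split => /=.
    - exact: T.
    - have := T (1 - y) (1 - y'); rewrite !subr_ge0 => /(_ y1 y1'); lra.
    - have := T (x - ((1 - y) * a%:~R + y * a'%:~R))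
        (x' - ((1 - y') * a%:~R + y' * a'%:~R)).
      rewrite !subr_ge0 => /(_ x0 x0'); lra.
    - have := T ((1 - y) * b%:~R + y * b'%:~R - x)
        ((1 - y') * b%:~R + y' * b'%:~R - x').
      rewrite !subr_ge0 => /(_ x1 x1'); lra.
  move=> _ [k /= kN <-] [px py] /=.
  have [c ck] : exists c : R, (c%:E <= tcoef (tpencil f g) k)%E.
    move: kN (tcoef_neqy (tpencil f g) k).
    by case: (tcoef _ _) => // c _ _; exists c.
  have [p _ [[pf ->]|[pg ->]]] := tpencil_termP ck;
    rewrite zvec_row_mx row_mxKl row_mxKr !mxE => /pt_inj/= [<- <-].
    have /andP[ap pb] := fab _ pf.
    by split; rewrite ?lexx ?ler01 //= subr0 !mul1r !mul0r !addr0 ler_int.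
  have /andP[ap pb] := gab _ pg.
  by split; rewrite ?lexx ?ler01 //= subrr !mul1r !mul0r !add0r ler_int.
have vertex (h : tpoly R 1) (y : int) :
    (forall p, p \in terms h ->
      tcoef (tpencil f g) (row_mx (const_mx p.1) (const_mx y)) = p.2%:E) ->
    forall i c, (i, c) \in terms h -> newt (tpencil f g) (pt i%:~R y%:~R).
  move=> hy i c /hy /= ic; apply: conv_hull_sub.
  exists (row_mx (const_mx i) (const_mx y)); first by rewrite /= ic.
  by rewrite zvec_row_mx row_mxKl row_mxKr !mxE.
have vf := vertex f 0 (fun p => (tpencil_generator f g p).1).
have vg := vertex g 1 (fun p => (tpencil_generator f g p).2).
move=> [x y] [/= y0 y1 xa xb].
have cN := (convex_setP _).1 (@conv_hull_convex R _ [set zvec i | i in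
  [set i | tcoef (tpencil f g) i != -oo%E]]).
have y01 : 0 <= 1 - y <= 1 by apply/andP; split; lra.
have side i c i' c' : (i, c) \in terms f -> (i', c') \in terms g ->
    newt (tpencil f g) (pt ((1 - y) * i%:~R + y * i'%:~R) y).
  move=> /vf fi /vg gi; have := cN _ _ _ y01 fi gi.
  by rewrite pt_comb subKr mulr0 add0r mulr1.
have [|t t01 xE] := segmentP (P := (1 - y) * a%:~R + y * a'%:~R)
  (Q := (1 - y) * b%:~R + y * b'%:~R) (x := x); first by rewrite xa xb.
have := cN _ _ _ t01 (side _ _ _ _ fa ga) (side _ _ _ _ fb gb).
by rewrite pt_comb -xE -mulrDl subrKC mul1r.
Qed.

Lemma integral_affine (L L' : R) :
  (\int[lebesgue_measure]_(y in `[0%R, 1%R]) ((1 - y) * L + y * L')%:E =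
   ((L + L') / 2)%:E)%E.
Proof.
pose F (y : R) := L * y + (L' - L) * (y ^+ 2 / 2).
have dF (y : R) : is_derive y 1 F ((1 - y) * L + y * L').
  rewrite /F; apply: is_derive_eq; rewrite /GRing.scale /=.
  by field.
have cF : continuous F.
  move=> y; apply: differentiable_continuous; apply/derivable1_diffP.
  by have [] := dF y.
rewrite (@continuous_FTC2 _ _ F).
- by rewrite -EFinB /F; congr (_%:E); field.
- exact: ltr01.
- apply: continuous_subspaceT => y.
  apply: cvgD; apply: cvgM; try exact: cvg_cst; try exact: cvg_id.
  by apply: cvgB; [exact: cvg_cst|exact: cvg_id].
- split.
  + by move=> y _; have [] := dF y.
  + by apply: cvg_at_right_filter; exact: cF.
  + by apply: cvg_at_left_filter; exact: cF.
by move=> y _; rewrite derive1E; have [] := dF y.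
Qed.

Lemma measurable_trapezoid (a b a' b' : R) : measurable (trapezoid a b a' b').
Proof.
have mh (h : R * R -> R) : measurable_fun setT h -> measurable [set p | 0 <= h p].
  move=> mh; rewrite [X in measurable X](_ : _ = setT `&` h @^-1` `[0, +oo[).
    exact: mh.
  by apply/seteqP; split => p /=; rewrite in_itv /= andbT // => -[].
have m1 : measurable_fun setT (@fst R R) by exact: measurable_fst.
have m2 : measurable_fun setT (@snd R R) by exact: measurable_snd.
have mc : measurable_fun setT (fun p : R * R => (1 - p.2) : R).
  by apply: measurable_funB => //; exact: measurable_cst.
have side (c c' : R) : measurable_fun setT (fun p : R * R => (1 - p.2) * c + p.2 * c').
  apply: measurable_funD; apply: measurable_funM => //.
rewrite [X in measurable X](_ : _ = [set p | 0 <= p.2] `&` [set p | 0 <= 1 - p.2]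
  `&` [set p | 0 <= p.1 - ((1 - p.2) * a + p.2 * a')]
  `&` [set p | 0 <= ((1 - p.2) * b + p.2 * b') - p.1]); last first.
  apply/seteqP; split => p /=; rewrite !subr_ge0; first by case.
  by move=> [[[]]].
apply: measurableI; [apply: measurableI; [apply: measurableI|]|]; apply: mh => //.
- exact: measurable_funB.
- exact: measurable_funB.
Qed.

Lemma ysection_trapezoid (a b a' b' y : R) :
  ysection (trapezoid a b a' b') y =
  if y \in `[0, 1] then `[(1 - y) * a + y * a', (1 - y) * b + y * b']%classic
  else set0.
Proof.
rewrite in_itv /=; apply/seteqP; split => x; rewrite /ysection /= inE /trapezoid /=.
  by move=> [-> -> xa xb]; rewrite /= in_itv /= xa xb.
by case: ifP => // /andP[y0 y1]; rewrite /= in_itv /= => /andP[xa xb].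
Qed.

(** Slicing horizontally turns the area into the integral of an affine
    function, which requires exchanging the factors of the product measure. *)
Lemma measure_trapezoid (a b a' b' : R) : a <= b -> a' <= b' ->
  (lebesgue_measure \x lebesgue_measure)%E (trapezoid a b a' b') =
  (((b - a) + (b' - a')) / 2)%:E.
Proof.
move=> ab ab'.
transitivity ((@lebesgue_measure R \x^ @lebesgue_measure R)%E (trapezoid a b a' b')).
  apply: product_measure_unique; last exact: measurable_trapezoid.
  by move=> A B mA mB; exact: product_measure2E.
rewrite -integral_affine /product_measure2 [RHS]integral_mkcond.
apply: eq_integral => y _; rewrite /= ysection_trapezoid patchE mem_setE.
case: ifP => [|_]; last exact: measure0.
rewrite in_itv /= => /andP[y0 y1]; rewrite lebesgue_measure_itv /= lte_fin.
have wide : 0 <= (1 - y) * (b - a) + y * (b' - a').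
  by rewrite addr_ge0 // mulr_ge0 // subr_ge0.
by case: ltP => h; rewrite -?EFinB; congr (_%:E); lra.
Qed.

(** The first two points span the line at height [s]; joining it to the third
    point reaches everything outside height [s']. *)
Lemma affine_setT (A : set 'rV[R]_(1 + 1)) x1 x2 x3 s s' :
  affine_set A -> x1 != x2 -> s != s' ->
  A (pt x1 s) -> A (pt x2 s) -> A (pt x3 s') -> A = setT.
Proof.
move=> affA x12 ss' A1 A2 A3; apply/seteqP; split => // v _.
have line u : A (pt u s).
  have := affA _ _ ((u - x2) / (x1 - x2)) A1 A2; rewrite pt_comb.
  congr (A (pt _ _)); last by lra.
  by field; rewrite subr_eq0.
have plane x y : y != s' -> A (pt x y).
  move=> ys'; pose t := (y - s') / (s - s').
  have s0 : s - s' != 0 by rewrite subr_eq0.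
  have y0 : y - s' != 0 by rewrite subr_eq0.
  have := affA _ _ t (line ((x - (1 - t) * x3) / t)) A3; rewrite pt_comb.
  congr (A (pt _ _)); rewrite /t; field; rewrite ?s0 //.
have [x [y ->]] := ptE v; have [ys'|/plane//] := eqVneq y s'.
(* A point at height [s'] extends to twice its length a segment that goes from
   height [s] to the middle height, where everything is already reached. *)
have mid : A (pt (x / 2) ((s + s') / 2)).
  apply: plane; apply: contra ss' => /eqP e; apply/eqP; lra.
have := affA _ _ 2 mid (line 0); rewrite pt_comb; congr (A (pt _ _)); lra.
Qed.

(** When the affine span is not the plane both sides of the trapezoid are
    points, so the area formula gives zero and covers the degenerate case. *)
Lemma vol_exponent_range f g (a b a' b' : int) :
  exponent_range f a b -> exponent_range g a' b' ->
  vol f g = (((b - a) + (b' - a'))%:~R / 2)%:E.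
Proof.
move=> fab gab; have NE := newt_tpencil fab gab.
have le_range h c d : @exponent_range R h c d -> c%:~R <= d%:~R :> R.
  by move=> [[x xc] _ /(_ _ xc) /andP[_]]; rewrite ler_int.
have [ab ab'] := (le_range _ _ _ fab, le_range _ _ _ gab).
have aE : area (newt (tpencil f g)) = (((b - a) + (b' - a'))%:~R / 2)%:E.
  by rewrite /area NE measure_trapezoid // !(rmorphD, rmorphN).
rewrite /vol aE; case: asboolP => // nospan; congr (_%:E).
pose S := affine_span (newt (tpencil f g)).
have affS : affine_set S.
  move=> x y t Sx Sy C [/= affC NC].
  exact: affC (Sx C (conj affC NC)) (Sy C (conj affC NC)).
have inS x y : trapezoid a%:~R b%:~R a'%:~R b'%:~R (x, y) -> S (pt x y).
  by rewrite -NE /= => Nxy C [_]; exact.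
have [Sa Sb Sa' Sb'] : [/\ S (pt a%:~R 0), S (pt b%:~R 0), S (pt a'%:~R 1) &
    S (pt b'%:~R 1)].
  by split; apply: inS; split => /=; lra.
have E : a = b.
  apply/eqP/negPn/negP => ab0; apply: nospan.
  by apply: (affine_setT affS _ _ Sa Sb Sa'); rewrite ?eqr_int // eq_sym oner_eq0.
have E' : a' = b'.
  apply/eqP/negPn/negP => ab0; apply: nospan.
  by apply: (affine_setT affS _ _ Sa' Sb' Sa); rewrite ?eqr_int // oner_eq0.
by rewrite E E' !subrr /= mul0r.
Qed.

End Volume.

(** * Expressions of a rational function *)

Section Expressions.
Context {R : realType}.
Implicit Types (f g : tpoly R 1) (phi : 'rV[R]_1 -> \bar R) (s : seq R).

Lemma envelope_neq0 f F : envelope (terms f) F -> f <> @tzero R 1.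
Proof.
move=> env /eqP; rewrite -terms_eq0 => /eqP f0.
by have [_ [p]] := env 0; rewrite f0.
Qed.

(** By uniqueness of the factorization, the number of roots of the function of
    a polynomial is the length of its Newton interval. *)
Lemma vol_roots f g c m s c' m' s' :
  envelope (terms f) (root_product c m s) ->
  envelope (terms g) (root_product c' m' s') ->
  vol f g = ((size s + size s')%:R / 2)%:E.
Proof.
move=> envf envg.
have [cf [mf [sf [envf' rf]]]] := tpoly_roots (envelope_neq0 envf).
have [cg [mg [sg [envg' rg]]]] := tpoly_roots (envelope_neq0 envg).
rewrite (vol_exponent_range rf rg).
have /root_product_roots/perm_size -> := envelope_uniq envf envf'.
have /root_product_roots/perm_size -> := envelope_uniq envg envg'.
have -> : mf + (size sf)%:Z - mf + (mg + (size sg)%:Z - mg) =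
  (size sf + size sg)%N%:Z by rewrite ![_ + Posz _]addrC !addrK.
by rewrite -pmulrn.
Qed.

(** A numerator equal to the zero polynomial would make [phi] constantly
    [-oo], so both polynomials factor. *)
Lemma texpresses_roots phi f g : phi <> (fun=> -oo%E) -> texpresses phi f g ->
  exists c m s c' m' s',
    [/\ envelope (terms f) (root_product c m s),
        envelope (terms g) (root_product c' m' s') &
        forall t, phi t =
          (root_product c m s (t 0 0) - root_product c' m' s' (t 0 0))%:E].
Proof.
move=> phi0 [g0 phiE].
have f0 : f <> @tzero R 1.
  move=> f0; apply: phi0; rewrite phiE f0; apply/funext => t.
  have -> : tquot (@tzero R 1) g t = (-oo - teval g t)%E.
    by rewrite /tquot /teval domf0 big_nil.
  by case: (teval g t).
have [c [m [s [envf _]]]] := tpoly_roots f0.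
have [c' [m' [s' [envg _]]]] := tpoly_roots g0.
exists c, m, s, c', m', s'; split => // t.
by rewrite phiE /tquot (teval_envelope envf) (teval_envelope envg).
Qed.

(** Cancelling a common root changes neither the quotient nor the monomial
    factors, and decreases the volume by one. *)
Lemma min_volume_roots_disjoint phi f g c m s c' m' s' :
  min_volume_expression phi f g ->
  envelope (terms f) (root_product c m s) ->
  envelope (terms g) (root_product c' m' s') ->
  forall r, r \in s -> r \notin s'.
Proof.
move=> [[_ phiE] minfg] envf envg r rs; apply/negP => rs'.
have [f1 [_ envf1]] := root_product_tpoly c m (rem r s).
have [g1 [g1N envg1]] := root_product_tpoly c' m' (rem r s').
have E1 : texpresses phi f1 g1.
  split => //; rewrite phiE; apply/funext => t.
  rewrite /tquot !(teval_envelope envf, teval_envelope envg,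
    teval_envelope envf1, teval_envelope envg1) -!EFinB; congr (_%:E).
  rewrite (root_product_perm _ _ (perm_to_rem rs)).
  rewrite (root_product_perm _ _ (perm_to_rem rs')).
  by rewrite /root_product !big_cons; lra.
have := minfg _ _ E1.
rewrite (vol_roots envf envg) (vol_roots envf1 envg1) lee_fin.
rewrite ler_pM2r ?invr_gt0 // ler_nat !size_rem //.
by case: (s) rs => // ? ? _; case: (s') rs' => // ? ? _ /=; lia.
Qed.

End Expressions.

Theorem theorem1p2 (R : realType) (phi : 'rV[R]_1 -> \bar R)
    (hphi : trational phi) (hphi0 : phi <> (fun=> -oo%E)) :
  (exists f g : tpoly R 1, min_volume_expression phi f g) /\
  (forall f g f' g' : tpoly R 1,
     min_volume_expression phi f g ->
     texpresses phi f' g' ->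
     vol f' g' = vol f g ->
     translation_of (dual_subdivision (tpencil f g))
                    (dual_subdivision (tpencil f' g'))).
Proof.
have halves f g : texpresses phi f g -> exists n : nat, vol f g = (n%:R / 2)%:E.
  move=> /(texpresses_roots hphi0)[c [m [s [c' [m' [s' [envf envg _]]]]]]].
  by exists (size s + size s')%N; exact: vol_roots envf envg.
split.
  (* Volumes of expressions are half-integers, so a smallest one is attained. *)
  pose attained n :=
    `[< exists f g, texpresses phi f g /\ vol f g = (n%:R / 2)%:E >].
  have ex : exists n, attained n.
    have [f [g fg]] := hphi; have [n nE] := halves _ _ fg.
    by exists n; apply/asboolP; exists f, g.
  have [n /asboolP[f [g [fg volfg]]] nmin] := ex_minnP ex.
  exists f, g; split; first exact: fg.
  move=> f'' g'' fg''; have [k kE] := halves _ _ fg''.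
  rewrite volfg kE lee_fin ler_pM2r ?invr_gt0 // ler_nat; apply: nmin.
  by apply/asboolP; exists f'', g''.
move=> f g f' g' minfg fg' eq_vol.
have minfg' : min_volume_expression phi f' g'.
  by split; [exact: fg' | move=> f'' g''; rewrite eq_vol; exact: minfg.2].
have [c1 [m1 [s1 [c2 [m2 [s2 [envf envg phiE]]]]]]] :=
  texpresses_roots hphi0 minfg.1.
have [c1' [m1' [s1' [c2' [m2' [s2' [envf' envg' phiE']]]]]]] :=
  texpresses_roots hphi0 fg'.
have cross x : root_product c1 m1 s1 x + root_product c2' m2' s2' x =
               root_product c1' m1' s1' x + root_product c2 m2 s2 x.
  have := phiE (const_mx x); rewrite phiE' !mxE => -[]; lra.
have /permP roots : perm_eq (s1 ++ s2') (s1' ++ s2).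
  apply: (@root_product_roots R (c1 + c2') (m1 + m2') _ (c1' + c2) (m1' + m2)).
  by move=> x; rewrite -!root_productM.
(* At each point one of the two multiplicities vanishes in either expression,
   and their difference is prescribed by [phi]. *)
have ss' : perm_eq s1 s1'.
  apply/allP => r _ /=; have := roots (pred1 r); rewrite !count_cat.
  have := min_volume_roots_disjoint minfg envf envg (r := r).
  have := min_volume_roots_disjoint minfg' envf' envg' (r := r).
  rewrite -!has_pred1 !has_count -!leqNgt => d' d cnt; apply/eqP.
  by move: (count _ s1) (count _ s2) (count _ s1') (count _ s2') d d' cnt; lia.
have affine x : root_product c1 m1 s1 x =
    root_product c1' m1' s1' x + (c1 - c1' + (m1 - m1')%:~R * x).
  rewrite (root_product_perm _ _ ss') /root_product rmorphB /=; lra.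
have affine' x : root_product c2 m2 s2 x =
    root_product c2' m2' s2' x + (c1 - c1' + (m1 - m1')%:~R * x).
  by have := cross x; rewrite affine; lra.
apply: (@translation_of_newt_up _ _ _ _ (pt3 (m1 - m1')%:~R 0 (c1 - c1'))).
apply: translate_subP.
  exact: newt_up_tpencil_shift envf envg envf' envg' affine affine'.
rewrite pt3N -rmorphN /= oppr0 !opprB.
apply: newt_up_tpencil_shift envf' envg' envf envg _ _ => x.
  by rewrite affine !rmorphB /=; lra.
by rewrite affine' !rmorphB /=; lra.
Qed.
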